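(* For every integer $d\geq 2$ and every integer $f\geq 1$ there exists a $d$-colored family $\mathcal{F}=\mathcal{F}_1\uplus\mathcal{F}_2\uplus\dots\uplus\mathcal{F}_d$ of convex sets in $\mathbb{R}^d$ that satisfies $\mathcal{CH}(\mathcal{F}_1,\dots,\mathcal{F}_d)$ and additionally: (1) for every $1\le i\le d$, at least $f$ points are needed to pierce the color class $\mathcal{F}_i$; (2) at least $\lceil\frac{d+1}{2}\rceil$ lines are necessary to cross $\bigcup_i\mathcal{F}_i$.
   Context: The family $\mathcal{F}$ is the disjoint union of the color classes $\mathcal{F}_1,\dots,\mathcal{F}_d$. It satisfies the Colorful Helly property $\mathcal{CH}(\mathcal{F}_1,\dots,\mathcal{F}_d)$ if every rainbow selection $K_i\in\mathcal{F}_i$, $1\le i\le d$, has $\bigcap_{i=1}^d K_i\neq\emptyset$. A set of points pierces (resp. a set of lines crosses) a family if every member of the family intersects at least one of these points (resp. lines). *)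

(* Defs.v *)
From HB Require Import structures.
From mathcomp Require Import all_boot all_order all_algebra.
From mathcomp Require Import all_classical all_reals all_analysis.
Set Implicit Arguments.
Unset Strict Implicit.
Unset Printing Implicit Defensive.
Import Order.TTheory GRing.Theory Num.Theory.
Local Open Scope classical_set_scope.
Local Open Scope ring_scope.

Definition colorful_helly (T : Type) (d : nat) (F : 'I_d -> set (set T)) : Prop :=
  forall K : 'I_d -> set T, (forall i, F i (K i)) ->
    \bigcap_(i in [set: 'I_d]) K i !=set0.

Definition pierces (T : Type) (P : set T) (G : set (set T)) : Prop :=
  forall K, G K -> exists2 p, P p & K p.

Definition is_line (R : realType) (d : nat) (l : set 'rV[R]_d) : Prop :=
  exists p v : 'rV[R]_d, v != 0 /\ l = range (fun t : R => p + t *: v).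

Definition crosses (T : Type) (L G : set (set T)) : Prop :=
  forall K, G K -> exists2 l, L l & K `&` l !=set0.

(* The classes are sets of sets, so their disjointness means that no set has
   two colors; it does not concern the points of R^d.  They are finite: without
   this, decreasing sequences of unbounded convex sets such as
   {x_0 >= n, x_1 >= x_0 ^ 2} cannot be crossed by finitely many lines. *)
Definition colored_convex_family (R : realType) (d : nat)
    (F : 'I_d -> set (set 'rV[R]_d)) : Prop :=
  [/\ forall i, finite_set (F i),
      trivIset [set: 'I_d] F
    & forall i K, F i K -> convex_set K].

(* Main.v *)
Require Import Defs.
From mathcomp Require Import all_boot all_order all_algebra.
From mathcomp Require Import all_classical all_reals all_analysis.
From mathcomp Require Import finmap ring lra zify.

(* Write a point of R^d as (t, x_1, ..., x_k), k = d - 1.  The color i >= 1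
   consists of 2f thin slabs |x_i - v_ij t - c_ij| <= eps, no three of which
   have a common point.  A choice s of one slab of each of these colors meets in a thick line M_s;
   the remaining color consists of hyperplanes t = const and of finitely many
   bounded pieces of hyperplanes that meet every M_s.

   A set of m lines with 2m <= d has directions spanning a space U with
   dim U <= d / 2.  For (v, c) in general position there is a hyperplane h
   parallel to U that meets every M_s, even when M_s is parallel to h: one has
   to solve linear equations saying that the parallel M_s lie in h, and general
   position bounds the number of equations that can be forced.  As the
   M_s are thick, there are m + 1 such parallel hyperplanes, and a line that is
   (almost) parallel to them meets at most one of them inside a bounded box.  So
   one of them is missed by all m lines.  Compactness of the set of directions
   reduces the hyperplanes to finitely many. *)

Set Implicit Arguments.
Unset Strict Implicit.
Unset Printing Implicit Defensive.
Import Order.TTheory GRing.Theory Num.Theory numFieldNormedType.Exports.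
Local Open Scope ring_scope.

(** * Properties that hold off the roots of a nonzero polynomial *)

Section Generic.
Variable F : realFieldType.

Definition generic (P : F -> Prop) :=
  exists2 p : {poly F}, p != 0 & forall x, p.[x] != 0 -> P x.

Lemma generic_ex P : generic P -> exists2 x, x != 0 & P x.
Proof.
case=> p p0 pP; have pX0 : p * 'X != 0 by rewrite mulf_neq0 ?polyX_eq0.
pose rs : seq F := [seq n%:R | n <- iota 0 (size (p * 'X))].
have urs : uniq rs by rewrite map_inj_uniq ?iota_uniq // => a b /eqP; rewrite eqr_nat => /eqP.
have : ~~ all (root (p * 'X)) rs.
  by apply/negP => /(max_poly_roots pX0)/(_ urs); rewrite size_map size_iota ltnn.
case/allPn => x _; rewrite /root hornerM hornerX mulf_eq0 negb_or => /andP[px x0].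
by exists x => //; apply: pP.
Qed.

Lemma generic_all (I : finType) (P : I -> F -> Prop) :
  (forall i, generic (P i)) -> generic (fun x => forall i, P i x).
Proof.
move=> /fin_all_exists2[p p0 pP]; exists (\prod_i p i).
  by apply/prodf_neq0 => i _.
move=> x; rewrite horner_prod => /prodf_neq0 h i; exact/pP/h.
Qed.

Lemma generic_and P Q : generic P -> generic Q -> generic (fun x => P x /\ Q x).
Proof.
move=> [p p0 pP] [q q0 qQ]; exists (p * q); first by rewrite mulf_neq0.
by move=> x; rewrite hornerM mulf_eq0 negb_or => /andP[/pP ? /qQ ?].
Qed.

Lemma generic_poly (p : {poly F}) : p != 0 -> generic (fun x => p.[x] != 0).
Proof. by exists p. Qed.

(** Choose P and Q such that P A Q is the identity of size [\rank A]. The determinant of P (A + x B)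
    Q is a polynomial in x with value 1 at 0, and where it is nonzero the rank cannot have
    dropped. *)
Lemma generic_rank m n (A B : 'M[F]_(m, n)) :
  generic (fun x => (\rank A <= \rank (A + x *: B)%R)%N).
Proof.
have /row_fullP[P PA] := col_base_full A.
have /row_freeP[Q AQ] := row_base_free A.
have PAQ : P *m A *m Q = 1%:M.
  have -> : P *m A = row_base A by rewrite -[RHS]mul1mx -PA -mulmxA mulmx_base.
  exact: AQ.
pose p : {poly F} := \det (map_mx polyC (P *m A *m Q) + 'X *: map_mx polyC (P *m B *m Q)).
have pE x : p.[x] = \det (P *m (A + x *: B) *m Q).
  rewrite -horner_evalE -det_map_mx; congr (\det _).
  rewrite mulmxDr mulmxDl -scalemxAr -scalemxAl.
  move: (P *m A *m Q) (P *m B *m Q) => C D; apply/matrixP => i j.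
  by rewrite !mxE -[LHS]/(((C i j)%:P + 'X * (D i j)%:P).[x]) !hornerE.
exists p; first by apply: contraTneq (oner_neq0 F) => p0; rewrite -(det1 F (\rank A)) -PAQ -[A in \det (P *m A *m Q)]addr0 -(scale0r B) -pE p0 horner0 eqxx.
move=> x; rewrite pE -unitfE -[_ \is a _]/(_ \in unitmx) => /mxrank_unit rk.
rewrite -[X in (X <= _)%N]rk; apply: (leq_trans (mxrankM_maxl _ _)).
exact: mxrankM_maxr.
Qed.

(* The moment curve leaves every proper subspace. *)
Lemma generic_avoid (I : finType) m n (D : 'M[F]_(m, n)) (w : I -> 'rV[F]_n) :
  (forall i, ~~ (w i <= D)%MS) ->
  exists2 psi : 'cV[F]_n, D *m psi = 0 & forall i, w i *m psi != 0.
Proof.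
move=> wD; pose u i := w i *m cokermx D.
(* As [w i] lies outside D, [u i] is nonzero; along the moment curve it becomes a nonzero polynomial
   in x. *)
have uE i x : u i *m (\col_j x ^+ j) = (rVpoly (u i)).[x]%:M.
  apply/matrixP => a b; rewrite !ord1 !mxE mulr1n horner_poly.
  by apply: eq_bigr => j _; rewrite valK mxE.
have [x _ px] : exists2 x, x != 0 & forall i, (rVpoly (u i)).[x] != 0.
  apply/generic_ex/generic_all => i; apply: generic_poly.
  apply: contra (wD i) => /eqP u0; rewrite submxE -/(u i).
  by rewrite -[u i]rVpolyK u0 linear0.
exists (cokermx D *m \col_j x ^+ j); first by rewrite mulmxA mulmx_coker mul0mx.
move=> i; rewrite mulmxA uE; apply: contra (px i) => /eqP/matrixP/(_ 0 0).
by rewrite !mxE mulr1n => ->.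
Qed.
End Generic.

(** * Spans of selected lines, formal and evaluated *)

Section Incidence.
Variables (F : realFieldType) (k n : nat).
Local Notation sel := {ffun 'I_k -> 'I_n}.
Local Notation cell := (option ('I_k * 'I_n)).

(* Homogeneous coordinates (c, t, x_1, ..., x_k) for affine functionals on
   R^(1+k): the line x_i = v_i t + c_i, t in R, of the selection s has direction
   [graph tvec v s] and passes through the point [graph cvec c s]. *)
Definition cvec : 'rV[F]_(2 + k) := delta_mx 0 (lshift k ord0).
Definition tvec : 'rV[F]_(2 + k) := delta_mx 0 (lshift k ord_max).
Definition xvec i : 'rV[F]_(2 + k) := delta_mx 0 (rshift 2 i).

Definition graph (b : 'rV[F]_(2 + k)) (v : 'M[F]_(k, n)) (s : sel) :=
  b + \sum_i v i (s i) *: xvec i.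

(** Formal coordinates of [graph b v s] modulo the [xvec i], i in T: the cell [None] stands for b,
    the cell (i, j) for [v i j *: xvec i]. They do not involve v, so their ranks are
    combinatorial. *)
Definition incidence_row (T : {set 'I_k}) (s : sel) : 'rV[F]_#|{: cell}| :=
  \row_a if enum_val a is Some ij then ((ij.1 \notin T) && (s ij.1 == ij.2))%:R
         else 1.
Definition eval_mx b (v : 'M[F]_(k, n)) : 'M[F]_(#|{: cell}|, 2 + k) :=
  \matrix_a if enum_val a is Some ij then v ij.1 ij.2 *: xvec ij.1 else b.

Lemma sum_option (V : nmodType) (T : finType) (f : option T -> V) :
  \sum_p f p = f None + \sum_x f (Some x).
Proof.
rewrite (bigD1 None) //=; congr (_ + _); apply/esym.
rewrite (reindex_omap Some id) => [|[x|]] //=.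
by apply: eq_bigl => x; rewrite eqxx.
Qed.

Lemma incidence_row_eval T s b v :
  incidence_row T s *m eval_mx b v = b + \sum_(i | i \notin T) v i (s i) *: xvec i.
Proof.
pose f (p : cell) : 'rV[F]_(2 + k) := if p is Some ij then
  ((ij.1 \notin T) && (s ij.1 == ij.2))%:R *: (v ij.1 ij.2 *: xvec ij.1) else b.
transitivity (\sum_p f p).
  rewrite mulmx_sum_row [RHS](reindex (fun a : 'I_#|{: cell}| => enum_val a)) /=; last exact/onW_bij/enum_val_bij.
  apply: eq_bigr => a _.
  by rewrite rowK mxE /f; case: (enum_val a) => [ij|] //; rewrite scale1r.
rewrite sum_option; congr (_ + _); rewrite -(pair_bigA _ (fun i j => f (Some (i, j)))) /=.
rewrite [RHS]big_mkcond; apply: eq_bigr => i _.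
rewrite (bigD1 (s i)) //= eqxx andbT big1 ?addr0 => [|j /negPf sj].
  by case: (i \notin T); rewrite ?scale1r ?scale0r.
by rewrite eq_sym sj andbF scale0r.
Qed.

Lemma graph_mod (T : {set 'I_k}) b v s m (D : 'M[F]_(m, 2 + k)) :
  (forall i, i \in T -> (xvec i <= D)%MS) ->
  (incidence_row T s *m eval_mx b v <= D)%MS = (graph b v s <= D)%MS.
Proof.
move=> TD; have sD : ((\sum_(i in T) v i (s i) *: xvec i)%R <= D)%MS.
  by apply: summx_sub => i iT; rewrite scalemx_sub ?TD.
have -> : graph b v s = incidence_row T s *m eval_mx b v + \sum_(i in T) v i (s i) *: xvec i.
  rewrite incidence_row_eval /graph -addrA (bigID (mem T)) /=; congr (_ + _).
  by rewrite addrC.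
apply/idP/idP => [h|]; first exact: addmx_sub.
move=> h; rewrite -[X in (X <= _)%MS](addrK (\sum_(i in T) v i (s i) *: xvec i)).
by rewrite addmx_sub ?eqmx_opp.
Qed.

(** Selections outside A give zero rows, so that the size of the matrix does not depend on A. *)
Definition incidence_mx T (A : {set sel}) : 'M[F]_(#|{: sel}|, #|{: cell}|) :=
  \matrix_a if enum_val a \in A then incidence_row T (enum_val a) else 0.
Definition mask_mx (T : {set 'I_k}) : 'M[F]_k :=
  \matrix_i if i \in T then delta_mx 0 i else 0.
Definition xvec_mx : 'M[F]_(k, 2 + k) := \matrix_i xvec i.

(* [span2 v c T A' A] is spanned by the vectors [xvec i], i in T, and, up to
   these, [graph tvec v s], s in A', and [graph cvec c s], s in A.  It is the
   image under [eval2 v c] of the space [incidence2 T A' A], which does not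
   depend on (v, c). *)
Definition incidence2 T A' A :=
  block_mx (mask_mx T) 0 0 (block_mx (incidence_mx T A') 0 0 (incidence_mx T A)).
Definition eval2 v c :=
  col_mx xvec_mx (col_mx (eval_mx tvec v) (eval_mx cvec c)).
Definition span2 v c T A' A := incidence2 T A' A *m eval2 v c.

Lemma span2E v c T A' A : span2 v c T A' A =
  col_mx (mask_mx T *m xvec_mx)
    (col_mx (incidence_mx T A' *m eval_mx tvec v) (incidence_mx T A *m eval_mx cvec c)).
Proof.
by rewrite /span2 /incidence2 /eval2 !mul_block_col !mul0mx !addr0 !add0r.
Qed.

Lemma rank_incidence2 T A' A : \rank (incidence2 T A' A) =
  (\rank (mask_mx T) + (\rank (incidence_mx T A') + \rank (incidence_mx T A)))%N.
Proof. by rewrite !rank_diag_block_mx. Qed.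

Lemma incidence_mx_sub (T : {set 'I_k}) (A : {set sel}) b v m (D : 'M[F]_(m, 2 + k)) :
  (forall i, i \in T -> (xvec i <= D)%MS) ->
  (incidence_mx T A *m eval_mx b v <= D)%MS <->
  (forall s, s \in A -> (graph b v s <= D)%MS).
Proof.
move=> TD; split => [/row_subP h s sA | h].
  have := h (enum_rank s); rewrite row_mul rowK enum_rankK sA.
  by rewrite graph_mod.
apply/row_subP => a; rewrite row_mul rowK; case: ifP => aA.
  by rewrite graph_mod // h.
by rewrite mul0mx sub0mx.
Qed.

Lemma span2_sub v c (T : {set 'I_k}) (A' A : {set sel}) m (D : 'M[F]_(m, 2 + k)) :
  (span2 v c T A' A <= D)%MS <->
  [/\ forall i, i \in T -> (xvec i <= D)%MS,
      forall s, s \in A' -> (graph tvec v s <= D)%MS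
    & forall s, s \in A -> (graph cvec c s <= D)%MS].
Proof.
have xD : (mask_mx T *m xvec_mx <= D)%MS <-> (forall i, i \in T -> (xvec i <= D)%MS).
  split => [/row_subP h i iT | h].
    by have := h i; rewrite row_mul rowK iT -rowE rowK.
  apply/row_subP => i; rewrite row_mul rowK; case: ifP => iT.
    by rewrite -rowE rowK h.
  by rewrite mul0mx sub0mx.
rewrite span2E !col_mx_sub; split => [/and3P[/xD TD /incidence_mx_sub vD /incidence_mx_sub cD]|].
  by split => //; [exact: vD | exact: cD].
case=> TD vD cD; apply/and3P; split; first exact/xD.
  exact/incidence_mx_sub.
exact/incidence_mx_sub.
Qed.

Lemma eval_mx_affine b v v1 x :
  eval_mx b (v + x *: v1) = eval_mx b v + x *: eval_mx 0 v1.
Proof.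
apply/row_matrixP => a; rewrite linearD linearZ /= !rowK.
case: (enum_val a) => [ij|]; last by rewrite scaler0 addr0.
by rewrite !mxE scalerDl scalerA.
Qed.

Lemma span2_affine v c v1 c1 T A' A x :
  span2 (v + x *: v1) (c + x *: c1) T A' A = span2 v c T A' A +
    x *: (incidence2 T A' A *m col_mx 0 (col_mx (eval_mx 0 v1) (eval_mx 0 c1))).
Proof.
rewrite /span2 scalemxAr -mulmxDr; congr (_ *m _).
by rewrite /eval2 !eval_mx_affine !scale_col_mx !add_col_mx scaler0 addr0.
Qed.

Lemma eval_mx_delta i j (y : 'rV[F]_#|{: cell}|) :
  y *m eval_mx 0 (delta_mx i j) = y 0 (enum_rank (Some (i, j))) *: xvec i.
Proof.
rewrite mulmx_sum_row (bigD1 (enum_rank (Some (i, j)))) //= rowK enum_rankK /=.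
rewrite mxE !eqxx scale1r big1 ?addr0 // => a ha; rewrite rowK.
case E: (enum_val a) => [[i' j']|] /=; last by rewrite scaler0.
rewrite mxE; case: eqP => [Ei|]; last by rewrite scale0r scaler0.
case: eqP => [Ej|]; last by rewrite scale0r scaler0.
by case/negP: ha; rewrite -[a]enum_valK E Ei Ej.
Qed.

Lemma eval_mx_lshift b v (e : 'I_2) (y : 'rV[F]_#|{: cell}|) :
  (y *m eval_mx b v) 0 (lshift k e) = y 0 (enum_rank None) * b 0 (lshift k e).
Proof.
rewrite mxE (bigD1 (enum_rank None)) //= mxE enum_rankK big1 ?addr0 // => a ha.
rewrite mxE; case E: (enum_val a) => [[i j]|] /=.
  by rewrite !mxE eq_lrshift andbF mulr0 mulr0.
by case/negP: ha; rewrite -[a]enum_valK E.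
Qed.

Lemma incidence_mx_mask (T : {set 'I_k}) A (y : 'rV[F]_#|{: sel}|) i j :
  i \in T -> (y *m incidence_mx T A) 0 (enum_rank (Some (i, j))) = 0.
Proof.
move=> iT; rewrite mxE big1 // => a _; rewrite mxE; case: ifP => _.
  by rewrite mxE enum_rankK /= iT mulr0.
by rewrite mxE mulr0.
Qed.

Lemma cell_row_neq0 (y : 'rV[F]_#|{: cell}|) :
  y 0 (enum_rank None) = 0 -> y != 0 ->
  exists i j, y 0 (enum_rank (Some (i, j))) != 0.
Proof.
move=> y0 /rV0Pn[a]; rewrite -[a]enum_valK; case: (enum_val a) => [[i j]|].
  by exists i, j.
by rewrite y0 eqxx.
Qed.

(* A kernel vector of [eval2 v c] on [incidence2 T A' A] has a nonzero entry in
   a cell (i, j) with i not in T; moving v i j or c i j turns its image into a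
   multiple of [xvec i]. *)
Lemma span2_deficient v c (T : {set 'I_k}) A' A :
  (\rank (span2 v c T A' A) < \rank (incidence2 T A' A))%N ->
  exists v1 c1 i, i \notin T /\ forall x, x != 0 ->
    (xvec i <= span2 (v + x *: v1)%R (c + x *: c1)%R T A' A)%MS.
Proof.
rewrite -(mxrank_mul_ker (incidence2 T A' A) (eval2 v c)) -[X in (X < _)%N]addn0.
rewrite ltn_add2l lt0n mxrank_eq0 => /rowV0Pn[r].
rewrite sub_capmx => /andP[/submxP[y ry] /sub_kermxP rL] r0.
pose y0 := lsubmx y; pose y1 := lsubmx (rsubmx y); pose y2 := rsubmx (rsubmx y).
pose b1 := y1 *m incidence_mx T A'; pose b2 := y2 *m incidence_mx T A.
have yE : y = row_mx y0 (row_mx y1 y2) by rewrite !hsubmxK.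
have rE : r = row_mx (y0 *m mask_mx T) (row_mx b1 b2).
  by rewrite ry yE /incidence2 !mul_row_block !mulmx0 !addr0 !add0r.
have L0 : y0 *m mask_mx T *m xvec_mx + (b1 *m eval_mx tvec v + b2 *m eval_mx cvec c) = 0.
  by rewrite -rL rE /eval2 !mul_row_col.
have xl (e : 'I_2) : (y0 *m mask_mx T *m xvec_mx) 0 (lshift k e) = 0.
  by rewrite mxE big1 // => i _; rewrite !mxE eq_lrshift andbF mulr0.
(* Only [tvec] has a t-coordinate and only [cvec] a c-coordinate, so the relation [L0] forces b1 and
   b2 to vanish at [None]. *)
have b10 : b1 0 (enum_rank None) = 0.
  have := congr1 (fun M : 'rV_(2 + k) => M 0 (lshift k ord_max)) L0.
  rewrite mxE [X in _ + X]mxE xl !eval_mx_lshift !mxE !eqxx /=.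
  by rewrite mulr0 mulr1 addr0 add0r.
have b20 : b2 0 (enum_rank None) = 0.
  have := congr1 (fun M : 'rV_(2 + k) => M 0 (lshift k ord0)) L0.
  rewrite mxE [X in _ + X]mxE xl !eval_mx_lshift !mxE !eqxx /=.
  by rewrite mulr0 mulr1 !add0r.
(* y kills the unperturbed span, so only the perturbation term remains. *)
have key v1 c1 x : y *m span2 (v + x *: v1) (c + x *: c1) T A' A =
    x *: (b1 *m eval_mx 0 v1 + b2 *m eval_mx 0 c1).
  rewrite span2_affine mulmxDr [y *m span2 _ _ _ _ _]mulmxA -ry rL add0r -scalemxAr mulmxA -ry rE.
  by rewrite !mul_row_col mulmx0 add0r.
have [b1n|/negPn/eqP b1z] := boolP (b1 != 0).
  have [i [j bij]] := cell_row_neq0 b10 b1n.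
  exists (delta_mx i j), 0, i; split.
    by apply: contraNN bij => iT; rewrite /b1 incidence_mx_mask.
  move=> x x0; have := key (delta_mx i j) 0 x.
  have -> : eval_mx 0 0 = 0 :> 'M[F]_(#|{: cell}|, 2 + k).
    by apply/row_matrixP => a; rewrite rowK row0; case: (enum_val a) => // ij; rewrite mxE scale0r.
  rewrite mulmx0 addr0 eval_mx_delta scalerA => E.
  rewrite -[xvec i](scalerK (_ : x * b1 0 (enum_rank (Some (i, j))) != 0)) ?mulf_neq0 //.
  by rewrite -E scalemx_sub // submxMl.
have [b2n|/negPn/eqP b2z] := boolP (b2 != 0).
  have [i [j bij]] := cell_row_neq0 b20 b2n.
  exists 0, (delta_mx i j), i; split.
    by apply: contraNN bij => iT; rewrite /b2 incidence_mx_mask.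
  move=> x x0; have := key 0 (delta_mx i j) x.
  rewrite b1z mul0mx add0r eval_mx_delta scalerA => E.
  rewrite -[xvec i](scalerK (_ : x * b2 0 (enum_rank (Some (i, j))) != 0)) ?mulf_neq0 //.
  by rewrite -E scalemx_sub // submxMl.
(* What is left is a relation among the [xvec i] alone, which are independent. *)
move: L0; rewrite b1z b2z !mul0mx !addr0 => z0.
case/negP: r0; rewrite rE b1z b2z.
suff -> : y0 *m mask_mx T = 0 by rewrite !row_mx0.
apply/rowP => i; have := congr1 (fun M : 'rV_(2 + k) => M 0 (rshift 2 i)) z0.
rewrite [LHS]mxE (bigD1 i) //= big1 ?addr0 => [|i' /negPf ii'].
  by rewrite [xvec_mx _ _]mxE [xvec _ _ _]mxE !eqxx mulr1 => ->; rewrite !mxE.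
by rewrite [xvec_mx _ _]mxE [xvec _ _ _]mxE eq_rshift eqxx /= eq_sym ii' mulr0.
Qed.

End Incidence.

(** * General position and the closure of a subspace *)

Section Closure.
Variables (F : realFieldType) (k n : nat).
Local Notation sel := {ffun 'I_k -> 'I_n}.
Local Notation mx := 'M[F]_(k, n).

(* The spaces [span2] are as large as combinatorics allows, unless they contain a
   new [xvec i]; this is all the general position that is needed. *)
Definition full_span (v c : mx) := forall (T : {set 'I_k}) (A' A : {set sel}),
  (forall i, i \notin T -> ~~ (xvec F i <= span2 v c T A' A)%MS) ->
  \rank (span2 v c T A' A) = \rank (incidence2 F T A' A).

(* A pair (v, c) with the largest sum of ranks works: by [span2_deficient] a
   generic perturbation of a bad pair increases this sum. *)
Lemma exists_full_span (Q : mx -> mx -> Prop) v0 c0 : Q v0 c0 ->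
  (forall v c v1 c1, Q v c -> generic (fun x => Q (v + x *: v1) (c + x *: c1))) ->
  exists v c, Q v c /\ full_span v c.
Proof.
move=> + Qgen.
pose cfg := ({set 'I_k} * ({set sel} * {set sel}))%type.
pose rk (v c : mx) (g : cfg) := \rank (span2 v c g.1 g.2.1 g.2.2).
pose defect (v c : mx) := (\sum_(g : cfg) (2 + k - rk v c g))%N.
have [r] := ubnP (defect v0 c0); elim: r v0 c0 => // r IH v c; rewrite ltnS => dr Qvc.
pose bad (g : cfg) := [forall i, (i \notin g.1) ==>
    ~~ (xvec F i <= span2 v c g.1 g.2.1 g.2.2)%MS] &&
  (rk v c g < \rank (incidence2 F g.1 g.2.1 g.2.2))%N.
have [[g /andP[/forallP gT gr]]|good] := altP (@existsP _ bad); last first.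
  exists v, c; split=> // T A' A Tx; apply/eqP; rewrite eqn_leq mxrankM_maxl leqNgt.
  move/existsPn: good => /(_ (T, (A', A))); rewrite /bad /=; apply: contra => ->.
  by rewrite andbT; apply/forallP => i; apply/implyP/Tx.
have [v1 [c1 [i [iT xi]]]] := span2_deficient gr.
have [x x0 [Qx rx]] : exists2 x, x != 0 & Q (v + x *: v1) (c + x *: c1) /\
    forall g, (rk v c g <= rk (v + x *: v1)%R (c + x *: c1)%R g)%N.
  apply/generic_ex/generic_and; first exact: Qgen.
  apply: generic_all => g'; rewrite /rk.
  have [p p0 pP] := generic_rank (span2 v c g'.1 g'.2.1 g'.2.2)
    (incidence2 F g'.1 g'.2.1 g'.2.2 *m col_mx 0 (col_mx (eval_mx 0 v1) (eval_mx 0 c1))).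
  by exists p => // x /pP; rewrite span2_affine.
apply: (IH (v + x *: v1) (c + x *: c1)) => //.
apply: leq_trans dr; rewrite /defect (bigD1 g) //= [X in (_ < X)%N](bigD1 g) //= -addSn.
apply: leq_add; last by apply: leq_sum => g' _; rewrite leq_sub2l.
(* Adding [xvec i] to the bad span raises its rank. The chosen x preserves the raised rank, and the
   perturbed span already contains [xvec i]. *)
have lt_g : (rk v c g < rk (v + x *: v1)%R (c + x *: c1)%R g)%N.
  have /span2_sub[TD1 A'D1 AD1] := submx_refl (span2 v c (i |: g.1) g.2.1 g.2.2).
  have /span2_sub[TD2 A'D2 AD2] := submx_refl (span2 (v + x *: v1)%R (c + x *: c1)%R g.1 g.2.1 g.2.2).
  apply: (@leq_trans (rk v c (i |: g.1, g.2))).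
    rewrite /rk ltnNge; apply/negP => /= le_rk.
    have le_sp : (span2 v c g.1 g.2.1 g.2.2 <= span2 v c (i |: g.1) g.2.1 g.2.2)%MS.
      by apply/span2_sub; split=> // j jT; apply: TD1; rewrite inE jT orbT.
    have := (mxrank_leqif_sup le_sp).2; rewrite eqn_leq le_rk mxrankS //= => /esym sp_le.
    have := implyP (gT i) iT; rewrite (submx_trans _ sp_le) //.
    by apply: TD1; rewrite finset.setU11.
  apply: leq_trans (rx _) _; apply: mxrankS; apply/span2_sub; split=> //= j.
  by rewrite !inE => /orP[/eqP ->|/TD2 //]; exact: xi.
have := rank_leq_col (span2 (v + x *: v1) (c + x *: c1) g.1 g.2.1 g.2.2).
by rewrite -/(rk (v + x *: v1)%R (c + x *: c1)%R g); move: lt_g; lia.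
Qed.

Lemma incidence_mx_subset (T : {set 'I_k}) (A A' : {set sel}) :
  A \subset A' -> (incidence_mx F T A <= incidence_mx F T A')%MS.
Proof.
move=> /fintype.subsetP AA; apply/row_subP => a; rewrite rowK; case: ifP => aA.
  by rewrite (eq_row_sub a) // rowK AA.
exact: sub0mx.
Qed.

Definition xset m (D : 'M[F]_(m, 2 + k)) := [set i | (xvec F i <= D)%MS].

(** The formal row of s is independent of those of A, as otherwise [graph cvec c s] would lie in D.
    If [xset] stays the same, both incidence blocks gain rank. If it grows, one unit comes from the
    t-block and, by [full_span], another from a new [xvec i], which lies outside D. *)
Lemma closure_step (v c : mx) (D : 'M[F]_(2 + k)) (A : {set sel}) s :
  full_span v c ->
  (forall s, s \in A -> (graph (tvec F k) v s <= D)%MS) ->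
  (forall s, s \in A -> (graph (cvec F k) c s <= D)%MS) ->
  (graph (tvec F k) v s <= D)%MS -> ~~ (graph (cvec F k) c s <= D)%MS ->
  (\rank (incidence2 F (xset D) A A) + 2 <=
   \rank (incidence2 F (xset (D + graph (cvec F k) c s)%MS) (s |: A) (s |: A)))%N.
Proof.
move=> fs At Ac st sc; set D' := (D + _)%MS.
have TD i : i \in xset D -> (xvec F i <= D)%MS by rewrite inE.
have AtD s' : s' \in s |: A -> (graph (tvec F k) v s' <= D)%MS.
  by rewrite !inE => /orP[/eqP -> //|/At].
have ZD : (span2 v c (xset D) (s |: A) A <= D)%MS by apply/span2_sub.
have Zfull : \rank (span2 v c (xset D) (s |: A) A) = \rank (incidence2 F (xset D) (s |: A) A).
  apply: fs => i; rewrite inE; apply: contra => h; exact: submx_trans h ZD.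
have sub_sA T : (\rank (incidence_mx F T A) <= \rank (incidence_mx F T (s |: A)))%N.
  by apply/mxrankS/incidence_mx_subset/finset.subsetUr.
have lt_sA : (\rank (incidence_mx F (xset D) A) < \rank (incidence_mx F (xset D) (s |: A)))%N.
  rewrite ltn_neqAle sub_sA andbT.
  rewrite (mxrank_leqif_sup (incidence_mx_subset _ (finset.subsetUr [set s] A))).2.
  apply: contra sc => /row_subP/(_ (enum_rank s)); rewrite rowK enum_rankK finset.setU11 => h.
  rewrite -(graph_mod _ _ _ TD) (submx_trans (submxMr _ h)) //.
  exact/incidence_mx_sub.
have [TT|TT] := eqVneq (xset D') (xset D).
  by rewrite TT !rank_incidence2; move: lt_sA; lia.
have sTT : xset D \subset xset D'.
  by apply/fintype.subsetP => i; rewrite !inE => /submx_trans -> //; exact: addsmxSl.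
have /fintype.properP[_ [i iD' iD]] : xset D \proper xset D' by rewrite finset.properEneq eq_sym TT.
pose Z' := span2 v c (xset D') (s |: A) A.
have /span2_sub[TZ' tZ' cZ'] := submx_refl Z'.
have ZZ' : (span2 v c (xset D) (s |: A) A <= Z')%MS.
  by apply/span2_sub; split => // j jD; apply: TZ'; apply: (fintype.subsetP sTT).
have : (\rank (span2 v c (xset D) (s |: A) A) < \rank Z')%N.
  rewrite ltn_neqAle mxrankS // andbT (mxrank_leqif_sup ZZ').2.
  apply: contra iD => h; rewrite inE (submx_trans _ ZD) //.
  by apply: submx_trans h; apply: TZ'.
have : (\rank Z' <= \rank (incidence2 F (xset D') (s |: A) A))%N by exact: mxrankM_maxl.
rewrite Zfull !rank_incidence2; have := sub_sA (xset D'); move: lt_sA; lia.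
Qed.

(* Starting from U, the missing points [graph cvec c s] are added one at a time.
   The invariant 2 dim D <= k + 1 + rank (incidence2 (xset D) A A), where A is
   the set of selections already satisfied, keeps D a proper subspace. *)
Lemma closure (v c : mx) (U : 'M[F]_(2 + k)) : full_span v c -> (2 * \rank U <= k.+1)%N ->
  exists D : 'M[F]_(2 + k), [/\ (U <= D)%MS, (\rank D <= k.+1)%N &
    forall s, (graph (tvec F k) v s <= D)%MS -> (graph (cvec F k) c s <= D)%MS].
Proof.
move=> fs rU.
suff H r (D : 'M[F]_(2 + k)) (A : {set sel}) : (2 + k - \rank D < r)%N -> (U <= D)%MS ->
    (forall s, s \in A -> (graph (cvec F k) c s <= D)%MS) ->
    (forall s, s \in A -> (graph (tvec F k) v s <= D)%MS) ->
    (2 * \rank D <= k.+1 + \rank (incidence2 F (xset D) A A))%N ->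
    exists D' : 'M[F]_(2 + k), [/\ (U <= D')%MS, (\rank D' <= k.+1)%N &
    forall s, (graph (tvec F k) v s <= D')%MS -> (graph (cvec F k) c s <= D')%MS].
  apply: (H _ U finset.set0) (ltnSn _) _ _ _ _ => //; try by move=> s; rewrite inE.
  by lia.
elim: r D A => // r IH D A; rewrite ltnS => Dr UD Ac At inv.
(* The span for A lies in D and has full rank, because [xset D] holds every [xvec i] of D. So the
   rank in the invariant is at most [\rank D]. *)
have ltD : (\rank D <= k.+1)%N.
  have ZD : (span2 v c (xset D) A A <= D)%MS by apply/span2_sub; split=> // i; rewrite inE.
  have := mxrankS ZD; rewrite fs; first by move: inv; lia.
  by move=> i; rewrite inE; apply: contra => h; exact: submx_trans h ZD.
have [good|] := boolP [forall s, (graph (tvec F k) v s <= D)%MS ==> (graph (cvec F k) c s <= D)%MS].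
  by exists D; split=> // s; exact/implyP/(forallP good).
case/forallPn => s; rewrite negb_imply => /andP[st sc].
have rD : \rank (D + graph (cvec F k) c s)%MS = (\rank D).+1.
  apply/eqP; rewrite eqn_leq; apply/andP; split.
    apply: leq_trans (mxrank_adds_leqif _ _) _; rewrite -[X in (_ <= X)%N]addn1 leq_add2l; exact: rank_leq_row.
  rewrite ltn_neqAle mxrankS ?addsmxSl // andbT (mxrank_leqif_sup (addsmxSl _ _)).2.
  by apply: contra sc => h; apply: submx_trans h; exact: addsmxSr.
apply: (IH (D + graph (cvec F k) c s)%MS (s |: A)).
- by rewrite rD; move: Dr ltD; lia.
- exact: submx_trans UD (addsmxSl _ _).
- move=> s'; rewrite !inE => /orP[/eqP ->|/Ac h]; first exact: addsmxSr.
  exact: submx_trans h (addsmxSl _ _).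
- move=> s'; rewrite !inE => /orP[/eqP ->|/At h]; first exact: submx_trans st (addsmxSl _ _).
  exact: submx_trans h (addsmxSl _ _).
- by have := closure_step fs At Ac st sc; rewrite rD; move: inv; lia.
Qed.

End Closure.

(** * A parallel hyperplane that contains all the lines parallel to it *)

Section ParallelHyperplane.
Variables (F : realFieldType) (k n : nat).

(* Vanishes iff the points (v i j, c i j), j = j1, j2, j3, are collinear, i.e. the
   lines x = v i j t + c i j are concurrent or parallel. *)
Definition concurrency (v c : 'M[F]_(k, n)) i j1 j2 j3 :=
  (v i j2 - v i j1) * (c i j3 - c i j1) - (v i j3 - v i j1) * (c i j2 - c i j1).

Definition no_three_concurrent v c :=
  forall i j1 j2 j3, uniq [:: j1; j2; j3] -> concurrency v c i j1 j2 j3 != 0.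

(** The points (j, j^2) lie on a parabola, and [concurrency] becomes a Vandermonde product. *)
Lemma no_three_concurrent_ex : exists v c, no_three_concurrent v c.
Proof.
exists (\matrix_(i, j) j%:R), (\matrix_(i, j) j%:R ^+ 2) => i j1 j2 j3 /=.
rewrite !inE negb_or andbT => /andP[/andP[j12 j13] j23]; rewrite /concurrency !mxE.
set a := j1%:R; set b := j2%:R; set e := j3%:R.
have -> : (b - a) * (e ^+ 2 - a ^+ 2) - (e - a) * (b ^+ 2 - a ^+ 2) =
  (b - a) * (e - a) * (e - b) :> F by ring.
by rewrite !mulf_neq0 ?subr_eq0 ?eqr_nat // eq_sym.
Qed.

Lemma no_three_concurrent_generic v c v1 c1 : no_three_concurrent v c ->
  generic (fun x => no_three_concurrent (v + x *: v1) (c + x *: c1)).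
Proof.
move=> vc; suff : generic (fun x => forall z : 'I_k * ('I_n * ('I_n * 'I_n)),
    uniq [:: z.2.1; z.2.2.1; z.2.2.2] ->
    concurrency (v + x *: v1) (c + x *: c1) z.1 z.2.1 z.2.2.1 z.2.2.2 != 0).
  by case=> p p0 pP; exists p => // x /pP h i j1 j2 j3; exact: (h (i, (j1, (j2, j3)))).
apply: generic_all => -[i [j1 [j2 j3]]].
have [uj|_] := boolP (uniq [:: j1; j2; j3]); last by exists 1; rewrite ?oner_eq0.
pose l (a : 'M[F]_(k, n)) a1 j j' : {poly F} := (a i j - a i j')%:P + 'X * (a1 i j - a1 i j')%:P.
pose p := l v v1 j2 j1 * l c c1 j3 j1 - l v v1 j3 j1 * l c c1 j2 j1.
have pE x : p.[x] = concurrency (v + x *: v1) (c + x *: c1) i j1 j2 j3.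
  by rewrite /p /l /concurrency !hornerE !mxE; ring.
exists p; last by move=> x; rewrite pE.
apply: contraTneq (vc i j1 j2 j3 uj) => p0; apply/negPn/eqP.
by have := pE 0; rewrite p0 horner0 !scale0r !addr0.
Qed.

Lemma graph_mul b v (s : {ffun 'I_k -> 'I_n}) (psi : 'cV[F]_(2 + k)) :
  (graph b v s *m psi) 0 0 = (b *m psi) 0 0 + \sum_i v i (s i) * psi (rshift 2 i) 0.
Proof.
rewrite mulmxDl mxE mulmx_suml summxE; congr (_ + _); apply: eq_bigr => i _.
by rewrite -scalemxAl -rowE !mxE.
Qed.

(** Close U, put at c-coordinate 0, to a proper subspace D, and let psi vanish on D but on no
    [graph tvec v s] outside D. If psi kills the direction of s, this direction is in D, hence so is
    the point of s, which fixes the level of its line. *)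
Lemma parallel_hyperplane : (0 < n)%N -> exists v c : 'M[F]_(k, n),
  no_three_concurrent v c /\
  forall m (U : 'M[F]_(m, k.+1)), (2 * m <= k.+1)%N ->
  exists (psi : 'cV[F]_k.+1) (c0 : F), [/\ psi != 0, U *m psi = 0 &
    forall s : {ffun 'I_k -> 'I_n},
      psi ord0 0 + \sum_i v i (s i) * psi (lift ord0 i) 0 = 0 ->
      \sum_i c i (s i) * psi (lift ord0 i) 0 = c0].
Proof.
move=> n0; have [v0 [c0 vc0]] := no_three_concurrent_ex.
have [v [c [vc fs]]] := exists_full_span vc0 no_three_concurrent_generic.
exists v, c; split=> // m U mk.
pose U1 : 'M[F]_(m, 2 + k) := row_mx (0 : 'cV_m) U.
have [|D [UD rD cD]] := closure (U := <<U1>>%MS) fs.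
  by rewrite genmxE; have := rank_leq_row U1; lia.
rewrite genmxE in UD.
have [w wD] : exists w : 'rV[F]_(2 + k), ~~ (w <= D)%MS.
  have /row_subPn[i wi] : ~~ (1%:M <= D)%MS.
    by apply/negP => /mxrankS; rewrite mxrank1; lia.
  by exists (row i 1%:M).
(* w makes psi nonzero; it also stands in for the directions in D, on which psi has to vanish. *)
pose wit (z : option {ffun 'I_k -> 'I_n}) := if z is Some s then
   if (graph (tvec F k) v s <= D)%MS then w else graph (tvec F k) v s else w.
have [|psi Dpsi wpsi] := @generic_avoid F _ _ _ D wit.
  by case=> [s|] //=; case: ifPn.
have sub0 (u : 'rV[F]_(2 + k)) : (u <= D)%MS -> u *m psi = 0.
  by case/submxP => y ->; rewrite -mulmxA Dpsi mulmx0.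
have tpsi : (tvec F k *m psi) 0 0 = psi (lshift k ord_max) 0 by rewrite -rowE mxE.
have cpsi : (cvec F k *m psi) 0 0 = psi (lshift k ord0) 0 by rewrite -rowE mxE.
have psiE : psi = col_mx (usubmx (psi : 'cV_(1 + k.+1))) (dsubmx (psi : 'cV_(1 + k.+1))).
  by rewrite vsubmxK.
have dpsi i : dsubmx (psi : 'cV_(1 + k.+1)) (lift ord0 i) 0 = psi (rshift 2 i) 0.
  by rewrite mxE; congr (psi _ _); apply: val_inj.
have dpsi0 : dsubmx (psi : 'cV_(1 + k.+1)) ord0 0 = psi (lshift k ord_max) 0.
  by rewrite mxE; congr (psi _ _); apply: val_inj.
have consistent (s : {ffun 'I_k -> 'I_n}) :
    psi (lshift k ord_max) 0 + \sum_i v i (s i) * psi (rshift 2 i) 0 = 0 ->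
    psi (lshift k ord0) 0 + \sum_i c i (s i) * psi (rshift 2 i) 0 = 0.
  move=> E; rewrite -cpsi -graph_mul sub0 ?mxE //; apply: cD.
  apply/negPn/negP => nD; have := wpsi (Some s); rewrite /= (negPf nD) => /negP[].
  by apply/eqP/matrixP => a b; rewrite !ord1 graph_mul tpsi E mxE.
exists (dsubmx (psi : 'cV_(1 + k.+1))), (- psi (lshift k ord0) 0); split.
(* With zero linear part, any selection (one exists as n > 0) forces the c-coordinate to vanish as
   well, so psi would kill w. *)
- apply/negP => /eqP d0; have /negP := wpsi None; apply.
  have dz i : psi (rshift 2 i) 0 = 0 by rewrite -dpsi d0 mxE.
  have c1 : psi (lshift k ord0) 0 = 0.
    have := consistent [ffun=> Ordinal n0]; rewrite !big1 ?addr0; [|by move=> i _; rewrite dz mulr0..].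
    by apply; rewrite -dpsi0 d0 mxE.
  suff -> : psi = 0 by rewrite mulmx0.
  rewrite psiE d0; apply/matrixP => a b; rewrite !ord1 !mxE.
  case: splitP => j _; last by rewrite mxE.
  by rewrite mxE !ord1 -c1; congr (psi _ _); apply: val_inj.
- have : U1 *m psi = 0 by case/submxP: UD => y ->; rewrite -mulmxA Dpsi mulmx0.
  by rewrite {1}psiE /U1 (mul_row_col (0 : 'cV_m)) mul0mx add0r.
- move=> s; rewrite dpsi0 => h; apply/eqP; rewrite -addr_eq0 addrC; apply/eqP.
  under eq_bigr => i _ do rewrite dpsi.
  by apply: consistent; rewrite -[RHS]h; under [in RHS]eq_bigr => i _ do rewrite dpsi.
Qed.

End ParallelHyperplane.

Local Open Scope classical_set_scope.

(** * Parallel bounded plates that meet every thick line *)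

Section Plates.
Variables (R : realType) (k n : nat).
Local Notation point := 'rV[R]_k.+1.
Local Notation sel := {ffun 'I_k -> 'I_n}.

Definition slab (v c : 'M[R]_(k, n)) (eps : R) i j : set point :=
  [set x | `|x 0 (lift ord0 i) - v i j * x 0 ord0 - c i j| <= eps].

Definition plate (psi : 'cV[R]_k.+1) (a B : R) : set point :=
  [set x | (x *m psi) 0 0 = a /\ forall j, `|x 0 j| <= B].

Lemma row_mul_psi (x : point) (psi : 'cV[R]_k.+1) : (x *m psi) 0 0 =
  x 0 ord0 * psi ord0 0 + \sum_i x 0 (lift ord0 i) * psi (lift ord0 i) 0.
Proof. by rewrite mxE big_ord_recl. Qed.

Definition pt (t : R) (f : 'I_k -> R) : point :=
  \row_j oapp f t (unlift ord0 j).

Lemma pt0 t f : pt t f 0 ord0 = t.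
Proof. by rewrite mxE unlift_none. Qed.

Lemma pt_lift t f i : pt t f 0 (lift ord0 i) = f i.
Proof. by rewrite mxE liftK. Qed.

(** A line on which psi is not constant reaches every level. The others lie at level c0, and their
    thickness allows small shifts that change psi. B bounds one witness for each of the finitely
    many pairs of a level and a selection. *)
Lemma parallel_plates (v c : 'M[R]_(k, n)) (eps : R) m (psi : 'cV[R]_k.+1) c0 : 0 < eps -> psi != 0 ->
  (forall s : sel, psi ord0 0 + \sum_i v i (s i) * psi (lift ord0 i) 0 = 0 ->
      \sum_i c i (s i) * psi (lift ord0 i) 0 = c0) ->
  exists a0 h B : R, [/\ h != 0, 0 < B & forall (l : 'I_m.+1) (s : sel),
    exists2 x, plate psi (a0 + l%:R * h) B x & forall i, slab v c eps i (s i) x].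
Proof.
move=> eps0 psi0 cons.
suff [a0 [h [h0 H]]] : exists a0 h : R, h != 0 /\ forall (l : 'I_m.+1) (s : sel),
    exists x, (x *m psi) 0 0 = a0 + l%:R * h /\ forall i, slab v c eps i (s i) x.
  have /fin_all_exists[q qP] : forall z : 'I_m.+1 * sel, exists x : point,
      (x *m psi) 0 0 = a0 + z.1%:R * h /\ forall i, slab v c eps i (z.2 i) x.
    by move=> z; exact: H.
  exists a0, h, (1 + \sum_z \sum_j `|q z 0 j|); split=> //.
    by rewrite ltr_pwDl // sumr_ge0 // => z _; rewrite sumr_ge0.
  move=> l s; have [q1 q2] := qP (l, s); exists (q (l, s)) => //; split=> // j.
  rewrite (bigD1 (l, s)) //= (bigD1 j) //= addrCA -addrA lerDl.
  by rewrite addr_ge0 ?sumr_ge0 // addr_ge0 // sumr_ge0 // => z _; rewrite sumr_ge0.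
pose speed (s : sel) := psi ord0 0 + \sum_i v i (s i) * psi (lift ord0 i) 0.
have moving a s : speed s != 0 -> exists x : point,
    (x *m psi) 0 0 = a /\ forall i, slab v c eps i (s i) x.
  move=> sp0; pose t := (a - \sum_i c i (s i) * psi (lift ord0 i) 0) / speed s.
  exists (pt t (fun i => v i (s i) * t + c i (s i))); split.
    rewrite row_mul_psi pt0.
    under eq_bigr => i _ do rewrite pt_lift mulrDl mulrAC.
    rewrite big_split -mulr_suml /= addrA [t * _]mulrC -mulrDl -/(speed s) /t.
    by rewrite mulrC divfK // subrK.
  by move=> i; rewrite /slab /= pt0 pt_lift addrAC addrK subrr normr0 ltW.
have [i0 /= hi0|allz] := pickP (fun i => psi (lift ord0 i) 0 != 0).
  (* As l <= m, the coordinate i0 can be shifted by l eps / (m + 1) without leaving the slab. *)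
  exists c0, (eps / m.+1%:R * psi (lift ord0 i0) 0); split.
    by rewrite !mulf_neq0 ?invr_eq0 ?pnatr_eq0 // gt_eqF.
  move=> l s; have [sp0|/moving //] := eqVneq (speed s) 0.
  pose d : R := l%:R * (eps / m.+1%:R).
  exists (pt 0 (fun i => c i (s i) + (i == i0)%:R * d)); split.
    rewrite row_mul_psi pt0 mul0r add0r.
    under eq_bigr => i _ do rewrite pt_lift mulrDl.
    rewrite big_split /= cons // (bigD1 i0) //= eqxx mul1r big1 ?addr0 => [|i /negPf ->].
      by rewrite /d !mulrA.
    by rewrite !mul0r.
  move=> i; rewrite /slab /= pt0 pt_lift mulr0 subr0 addrAC subrr add0r.
  case: eqP => _; last by rewrite mul0r normr0 ltW.
  rewrite mul1r /d ger0_norm ?mulr_ge0 ?invr_ge0 ?ler0n ?(ltW eps0) //.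
  rewrite mulrCA ger_pMr // ler_pdivrMr ?ltr0n // mul1r ler_nat.
  exact/ltnW/ltn_ord.
(* Now psi depends on t only, so it is constant on no line. *)
have psi00 : psi ord0 0 != 0.
  apply: contra_neq psi0 => p0; apply/colP => j; rewrite !mxE.
  by case: (unliftP ord0 j) => [i|] ->; [exact/eqP/negbFE/allz | ].
exists 0, 1; split; first exact: oner_neq0.
move=> l s; apply: moving; rewrite /speed big1 ?addr0 // => i _.
by have /negbFE/eqP -> := allz i; rewrite mulr0.
Qed.

(* Two points of one line in two parallel plates differ by a bounded multiple
   of the direction, so the direction cannot be almost parallel to the plates. *)
Lemma line_meets_one_plate psi a0 h B (p u : point) m (l l' : 'I_m) t t' j :
  `|u 0 j| = 1 -> `|(u *m psi) 0 0| * (2 * B) < `|h| ->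
  plate psi (a0 + l%:R * h) B (p + t *: u) ->
  plate psi (a0 + l'%:R * h) B (p + t' *: u) -> l = l'.
Proof.
move=> uj uh [e b] [e' b']; apply/eqP/negPn/negP => ll'.
have E : (t - t') * (u *m psi) 0 0 = (l%:R - l'%:R) * h.
  have -> : (l%:R - l'%:R) * h = (a0 + l%:R * h) - (a0 + l'%:R * h) by ring.
  by rewrite -e -e' !mulmxDl -!scalemxAl !mxE; ring.
have tB : `|t - t'| <= 2 * B.
  have -> : `|t - t'| = `|(p + t *: u) 0 j - (p + t' *: u) 0 j|.
    have -> : (p + t *: u) 0 j - (p + t' *: u) 0 j = (t - t') * u 0 j.
      by rewrite !mxE; ring.
    by rewrite normrM uj mulr1.
  by rewrite (le_trans (ler_normB _ _)) // mulrDl mul1r lerD.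
have : `|h| <= `|t - t'| * `|(u *m psi) 0 0|.
  rewrite -normrM E normrM ler_peMl //.
  have : (1 <= `|(l%:Z - l'%:Z)|)%R by move/eqP: ll' => ll'; have : (l : nat) <> l' by [move/val_inj]; lia.
  by rewrite -(ler_int R) intr_norm intrD mulrNz.
apply/negP; rewrite -ltNge; apply: le_lt_trans uh; rewrite mulrC.
by rewrite ler_wpM2l.
Qed.

End Plates.

(** * Compactness: finitely many plates suffice *)

Section FinitePlates.
Variables (R : realType) (k n : nat).
Local Notation point := 'rV[R]_k.+1.
Local Notation sel := {ffun 'I_k -> 'I_n}.

Lemma continuous_sum (T : topologicalType) (I : finType) (f : I -> T -> R) :
  (forall i, continuous (f i)) -> continuous (fun x => \sum_i f i x).
Proof.
move=> cf; elim: (index_enum I) => [|i r IH].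
  by under eq_fun do rewrite big_nil; move=> x; exact: cvg_cst.
by under eq_fun do rewrite big_cons; move=> x; apply: cvgD; [exact: cf | exact: IH].
Qed.

Lemma sum_norm_continuous m (psi : 'cV[R]_k.+1) : continuous
  (fun W : 'rV[R]_(m * k.+1) => \sum_a `|\sum_j W 0 (mxvec_index a j) * psi j 0|).
Proof.
have cs a : continuous (fun W : 'rV[R]_(m * k.+1) => \sum_j W 0 (mxvec_index a j) * psi j 0).
  apply: continuous_sum => j W.
  have cj := @coord_continuous R 1 (m * k.+1) 0 (mxvec_index a j) W.
  by apply: (cvgM cj (cvg_cst (psi j 0))).
have cn a : continuous (fun W : 'rV[R]_(m * k.+1) => `|\sum_j W 0 (mxvec_index a j) * psi j 0|).
  by move=> W; exact: cvg_norm (cs a W).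
exact: (continuous_sum cn).
Qed.

Lemma normalize_row (u : point) : u != 0 ->
  exists2 j, u 0 j != 0 & forall i, `|u 0 i| <= `|u 0 j|.
Proof.
move=> u0; pose F j := `|u 0 j|; have [j _ uj] := @Order.TotalTheory.arg_maxP _ R 'I_k.+1 ord0 xpredT F isT.
exists j; last by move=> i; exact: uj.
apply: contra u0 => /eqP uj0; apply/eqP/rowP => i; rewrite mxE; apply/eqP.
by have := uj i isT; rewrite /F /= uj0 normr0 normr_le0.
Qed.

Definition meets_rainbow (v c : 'M[R]_(k, n)) eps (K : set point) :=
  forall s : sel, exists2 x, K x & forall i, slab v c eps i (s i) x.

(** The m + 1 parallel plates of a tuple of m directions still serve all nearby tuples. Normalized
    tuples lie in a compact cube, so finitely many neighborhoods cover them. *)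
Lemma finite_plates (v c : 'M[R]_(k, n)) (eps : R) m : 0 < eps ->
  (forall U : 'M[R]_(m, k.+1), exists (psi : 'cV[R]_k.+1) (c0 : R),
    [/\ psi != 0, U *m psi = 0 & forall s : sel,
      psi ord0 0 + \sum_i v i (s i) * psi (lift ord0 i) 0 = 0 ->
      \sum_i c i (s i) * psi (lift ord0 i) 0 = c0]) ->
  exists G : set (set point), [/\ finite_set G,
    forall K, G K -> meets_rainbow v c eps K /\ exists psi a B, K = plate psi a B
    & forall p u : 'I_m -> point, (forall a, u a != 0) ->
      exists2 K, G K & forall a t, ~ K (p a + t *: u a)].
Proof.
move=> eps0 ph.
pose data : Type := ('cV[R]_k.+1 * (R * (R * R)))%type.
pose pl (z : data) (l : 'I_m.+1) : set point := plate z.1 (z.2.1 + l%:R * z.2.2.1) z.2.2.2.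
pose dev (z : data) (W : 'rV[R]_(m * k.+1)) : R :=
  \sum_a `|\sum_j W 0 (mxvec_index a j) * z.1 j 0|.
have good (U : 'rV[R]_(m * k.+1)) : exists z : data,
    [/\ z.2.2.1 != 0, 0 < z.2.2.2, dev z U = 0 & forall l, meets_rainbow v c eps (pl z l)].
  have [psi [c0 [psi0 Upsi cons]]] := ph (vec_mx U).
  have [a0 [h [B [h0 B0 H]]]] := parallel_plates m eps0 psi0 cons.
  exists (psi, (a0, (h, B))); split=> //.
  rewrite /dev big1 // => a _; apply/eqP; rewrite normr_eq0; apply/eqP.
  move/colP/(_ a): Upsi; rewrite !mxE => E; rewrite -[RHS]E.
  by apply: eq_bigr => j _; rewrite [vec_mx _ _ _]mxE.
have [z zP] := choice good.
(* Below this deviation [line_meets_one_plate] applies to every direction of the tuple. *)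
pose thr (y : data) := `|y.2.2.1| / (2 * y.2.2.2).
pose near U := [set W | dev (z U) W < thr (z U)].
pose cube : set 'rV[R]_(m * k.+1) := [set W | forall i, `[-1, 1]%classic (W 0 i)].
have cube_compact : compact cube.
  by apply: (@rV_compact R _ (fun=> `[-1, 1]%classic)) => i; exact: segment_compact.
rewrite compact_cover in cube_compact.
have [D _ Dcover] : finite_subset_cover setT near cube.
  apply: cube_compact => [U _|W _].
    apply: (@open_comp _ _ (dev (z U)) [set y | y < thr (z U)]); last exact: open_lt.
    by move=> W _; exact: sum_norm_continuous.
  exists W => //; have [h0 B0 dW _] := zP W.
  by rewrite /near /= dW /thr divr_gt0 ?normr_gt0 ?mulr_gt0.
exists [set pl (z x.1) x.2 | x in [set` D] `*` [set: 'I_m.+1]]; split.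
- by apply: finite_image; apply: finite_setX.
- move=> K [[U l] _ <-]; have [_ _ _ h] := zP U; split; first exact: h.
  by do 3 eexists; reflexivity.
move=> p u u0.
have /fin_all_exists[j jP] a : exists j, u a 0 j != 0 /\ forall i, `|u a 0 i| <= `|u a 0 j|.
  by have [j ? ?] := normalize_row (u0 a); exists j.
pose u' a : point := (u a 0 (j a))^-1 *: u a.
pose W : 'rV[R]_(m * k.+1) := mxvec (\matrix_(a, i) u' a 0 i).
have uj0 a : 0 < `|u a 0 (j a)| by rewrite normr_gt0; case: (jP a).
have cW : cube W.
  move=> i; rewrite /W; case/mxvec_indexP: i => a i; rewrite mxvecE !mxE.
  rewrite /= in_itv /= -ler_norml normrM normfV mulrC ler_pdivrMr ?mul1r //.
  by case: (jP a).
have [U UD WU] := Dcover _ cW.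
have [h0 B0 _ _] := zP U.
have dev_a a : `|(u' a *m (z U).1) 0 0| * (2 * (z U).2.2.2) < `|(z U).2.2.1|.
  rewrite -ltr_pdivlMr ?mulr_gt0 //; apply: le_lt_trans WU.
  rewrite /dev (bigD1 a) //= ler_wpDr ?sumr_ge0 // le_eqVlt; apply/orP; left; apply/eqP.
  by congr `|_|; rewrite mxE; apply: eq_bigr => i _; rewrite mxvecE [X in _ = X * _]mxE.
(* Pigeonhole: if all m + 1 plates were hit, one line would hit two of them. *)
have [l lP] : exists l, forall a t, ~ pl (z U) l (p a + t *: u a).
  apply: contrapT => /forallNP hit.
  have /fin_all_exists[g gP] l : exists a, exists t, pl (z U) l (p a + t *: u a).
    apply: contrapT => /forallNP nh; apply: (hit l) => a t ht; apply: (nh a).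
    by exists t.
  have /leq_card : injective g.
    move=> l l' gll; have [t ht] := gP l; have [t' ht'] := gP l'; rewrite -gll in ht'.
    have uE s : s *: u (g l) = (s * u (g l) 0 (j (g l))) *: u' (g l).
      by rewrite scalerA mulfK //; case: (jP (g l)).
    rewrite uE in ht; rewrite uE in ht'.
    apply: (line_meets_one_plate (j := j (g l)) _ (dev_a (g l)) ht ht').
    by rewrite /u' mxE mulVf ?normr1 //; case: (jP (g l)).
  by rewrite !card_ord ltnn.
by exists (pl (z U) l) => //; exists (U, l).
Qed.

End FinitePlates.

(** * Counting points and lines *)

Section Piercing.

Lemma card_ge_injective (T : Type) (P : set T) f (p : 'I_f -> T) :
  injective p -> (forall l, P (p l)) -> (`I_f #<= P)%card.
Proof.
case: f p => [|f] p pI Pp; first by rewrite II0; exact: card_ge0.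
have q_inj : {in `I_f.+1 &, injective (p \o @inord f)}.
  move=> i j /set_mem/= lti /set_mem/= ltj /pI/(congr1 val) /=.
  by rewrite !inordK.
have := inj_card_eq q_inj; rewrite card_eq_sym => /card_eqPle[le _].
by apply: card_le_trans le _; apply: subset_card_le => _ [i _ <-]; exact: Pp.
Qed.

Lemma card_ge_half (T : choiceType) (P : set T) f (p : 'I_(2 * f) -> T) :
  (forall j1 j2 j3, uniq [:: j1; j2; j3] -> p j1 = p j2 -> p j1 = p j3 -> False) ->
  (forall j, P (p j)) -> (`I_f #<= P)%card.
Proof.
move=> no3 Pp; pose im := undup [seq p j | j <- enum 'I_(2 * f)].
have p_im j : p j \in im by rewrite mem_undup map_f // mem_enum.
have im_size : (f <= size im)%N.
  (* As each point is taken at most twice, an index is determined by its point and by whether an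
     earlier index has the same point. *)
  pose later (j : 'I_(2 * f)) := [exists j' : 'I_(2 * f), (j' < j)%N && (p j' == p j)].
  pose code j := (Ordinal (etrans (index_mem (p j) im) (p_im j)), later j).
  have : injective code.
    suff lt_code (j j' : 'I_(2 * f)) : (j < j')%N -> code j <> code j'.
      move=> j j' e; apply: val_inj; case: (ltngtP j j') => // h.
        by case: (lt_code _ _ h).
      by case: (lt_code _ _ h).
    move=> jj' [e1 e2]; have pE : p j = p j'.
      by rewrite -[LHS](nth_index (p j) (p_im j)) e1 nth_index // p_im.
    have : later j' by apply/existsP; exists j; rewrite jj' pE /=.
    rewrite -e2 => /existsP[j'' /andP[j''j /eqP pE']].
    apply: (no3 j j' j'') => //.
    rewrite /= !inE negb_or andbT -!val_eqE /= !neq_ltn jj' j''j /= !orbT /=.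
    by rewrite (ltn_trans j''j jj') orbT.
  by move/leq_card; rewrite card_prod !card_ord card_bool; lia.
have size_lt (l : 'I_f) : (l < size im)%N by apply: leq_trans im_size.
have [f0|fpos] := posnP f; first by rewrite f0 II0; exact: card_ge0.
have pos2f : (0 < 2 * f)%N by rewrite muln_gt0.
pose x0 := p (Ordinal pos2f).
apply: (@card_ge_injective _ _ _ (fun l : 'I_f => nth x0 im l)) => [l l' /eqP|l].
  by rewrite nth_uniq ?undup_uniq // => /eqP/val_inj.
have : nth x0 im l \in im by rewrite mem_nth.
by rewrite mem_undup => /mapP[j _ ->].
Qed.

(** The value [t0] fills the list when A has fewer than q elements. *)
Lemma card_lt_enum (T : Type) (t0 : T) (A : set T) q : ~ (`I_q.+1 #<= A)%card ->
  exists g : 'I_q -> T, forall x, A x -> exists a, g a = x.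
Proof.
move=> nle.
have finA : finite_set A.
  apply: contrapT => /infiniteP h; apply: nle; apply: card_le_trans h.
  by apply: subset_card_le.
have [r Ar] := (finite_setP A).1 finA.
have rq : (r <= q)%N.
  rewrite leqNgt; apply/negP => qr; apply: nle.
  move: Ar; rewrite card_eq_sym => /card_eqPle[Ar _]; apply: card_le_trans Ar.
  by rewrite card_le_II.
have /card_set_bijP[h [hA hI _]] := Ar.
have /fin_all_exists[g gP] (a : 'I_q) : exists x, (exists2 y, A y & h y = a) -> A x /\ h x = a.
  have [[y Ay hy]|none] := pselect (exists2 y, A y & h y = a); last by exists t0.
  by exists y.
exists g => x Ax; have hxq : (h x < q)%N by apply: leq_trans rq; exact: hA.
exists (Ordinal hxq); have [|Ag hg] := gP (Ordinal hxq); first by exists x.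
by apply: hI; [exact: mem_set | exact: mem_set | rewrite hg].
Qed.

Lemma eps_for_finite (R : realFieldType) (I : finType) (a b : I -> R) :
  (forall z, 0 <= a z) -> (forall z, 0 < b z) ->
  exists2 eps, 0 < eps & forall z, eps * a z < b z.
Proof.
move=> a0 b0; exists (1 + \sum_z a z / b z)^-1.
  by rewrite invr_gt0 ltr_pwDl // sumr_ge0 // => z _; rewrite divr_ge0 // ltW.
move=> z; rewrite mulrC ltr_pdivrMr; last first.
  by rewrite ltr_pwDl // sumr_ge0 // => y _; rewrite divr_ge0 // ltW.
rewrite mulrC -ltr_pdivrMr // ltr_pwDl // (bigD1 z) //= lerDl sumr_ge0 // => y _.
by rewrite divr_ge0 // ltW.
Qed.

End Piercing.

(** * Convexity of the members and separation of the colors *)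

Section Family.
Variables (R : realType) (k : nat).
Local Notation point := 'rV[R]_k.+1.

Lemma convex_set01 (A : set point) :
  (forall x y a, 0 <= a -> a <= 1 -> A x -> A y -> A (a *: x + (1 - a) *: y)) ->
  convex_set A.
Proof.
move=> AP x y l /set_mem Ax /set_mem Ay; apply/mem_set.
by apply: (AP x y l%:num).
Qed.

Lemma convex_comb_norm (a r x y : R) : 0 <= a -> a <= 1 ->
  `|x| <= r -> `|y| <= r -> `|a * x + (1 - a) * y| <= r.
Proof. by move=> a0 a1; rewrite !ler_norml => /andP[x1 x2] /andP[y1 y2]; apply/andP; split; nra. Qed.

(** Being disjoint, f of these force f points for the color [ord0]. *)
Definition level (l : nat) : set point := [set x | x 0 ord0 = l%:R].

Lemma level_convex l : convex_set (level l).
Proof.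
apply: convex_set01 => x y a _ _; rewrite /level /= !mxE => -> ->.
by rewrite -mulrDl addrC subrK mul1r.
Qed.

Lemma plate_convex psi a B : convex_set (plate psi a B : set point).
Proof.
apply: convex_set01 => x y b b0 b1 [x1 x2] [y1 y2]; split.
  rewrite mulmxDl -!scalemxAl mxE [X in X + _]mxE [X in _ + X]mxE x1 y1.
  by rewrite -mulrDl addrC subrK mul1r.
by move=> j; rewrite !mxE; apply: convex_comb_norm.
Qed.

Variables (n : nat) (v c : 'M[R]_(k, n)).

Lemma slab_convex eps i j : convex_set (slab v c eps i j).
Proof.
apply: convex_set01 => x y a a0 a1; rewrite /slab /= => x1 y1.
rewrite !mxE (_ : _ - _ - _ = a * (x 0 (lift ord0 i) - v i j * x 0 ord0 - c i j) +
  (1 - a) * (y 0 (lift ord0 i) - v i j * y 0 ord0 - c i j)); last by ring.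
exact: convex_comb_norm.
Qed.

(** A slab has points with arbitrary t and arbitrary coordinates other than i; this tells it from
    levels, plates and slabs of other colors. *)
Lemma slab_pt eps i j t y : 0 <= eps ->
  slab v c eps i j (pt t (fun i' => if i' == i then v i j * t + c i j else y)).
Proof.
by move=> eps0; rewrite /slab /= pt0 pt_lift eqxx addrAC addrK subrr normr0.
Qed.

Lemma slab_neq_level eps i j l : 0 <= eps -> slab v c eps i j <> level l.
Proof.
move=> eps0 E; have := slab_pt i j (l%:R + 1) 0 eps0; rewrite E /level /= pt0.
by move/eqP; rewrite -subr_eq0 addrAC subrr add0r oner_eq0.
Qed.

Lemma slab_neq_plate eps i j psi a B : 0 <= eps -> slab v c eps i j <> plate psi a B.
Proof.
move=> eps0 E; have := slab_pt i j (B + 1) 0 eps0; rewrite E => -[_ /(_ ord0)].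
rewrite pt0; apply/negP; rewrite -ltNge; apply: lt_le_trans (ler_norm _).
by rewrite ltrDl.
Qed.

Lemma slab_inj_color eps i i' j j' : 0 <= eps ->
  slab v c eps i j = slab v c eps i' j' -> i = i'.
Proof.
move=> eps0 E; apply/eqP/negPn/negP => ii'.
have := slab_pt i j 0 (c i' j' + eps + 1) eps0.
rewrite E /slab /= pt0 pt_lift eq_sym (negPf ii') mulr0 subr0 addrAC [c i' j' + eps]addrC addrK.
by rewrite ger0_norm ?addr_ge0 // gerDl ler10.
Qed.

(** [concurrency] is a fixed combination of differences of the residuals r1, r2, r3 of any point. If
    all are at most eps in size, it is at most eps times a constant, too small once eps is. *)
Lemma slabs_not_concurrent : no_three_concurrent v c ->
  exists2 eps, 0 < eps & forall i j1 j2 j3 x, uniq [:: j1; j2; j3] ->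
    slab v c eps i j1 x -> slab v c eps i j2 x -> slab v c eps i j3 x -> False.
Proof.
move=> vc.
pose a (z : 'I_k * ('I_n * ('I_n * 'I_n))) := 2 *
  (`|v z.1 z.2.2.1 - v z.1 z.2.1| + `|v z.1 z.2.2.2 - v z.1 z.2.1|).
pose b (z : 'I_k * ('I_n * ('I_n * 'I_n))) :=
  if uniq [:: z.2.1; z.2.2.1; z.2.2.2]
  then `|concurrency v c z.1 z.2.1 z.2.2.1 z.2.2.2| else 1.
have [||eps eps0 epsP] := @eps_for_finite R _ a b.
- by move=> z; rewrite mulr_ge0 // addr_ge0.
- by move=> z; rewrite /b; case: ifP => // /vc u; rewrite normr_gt0.
exists eps => // i j1 j2 j3 x uj.
rewrite /slab /=; set r1 := _ - c i j1; set r2 := _ - c i j2; set r3 := _ - c i j3.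
move=> h1 h2 h3; have := epsP (i, (j1, (j2, j3))); rewrite /a /b /= -/(uniq [:: j1; j2; j3]) uj.
have -> : concurrency v c i j1 j2 j3 =
    (v i j2 - v i j1) * (r1 - r3) - (v i j3 - v i j1) * (r1 - r2).
  by rewrite /concurrency /r1 /r2 /r3; ring.
have h13 : `|r1 - r3| <= 2 * eps by rewrite (le_trans (ler_normB _ _)) // mulrDl mul1r lerD.
have h12 : `|r1 - r2| <= 2 * eps by rewrite (le_trans (ler_normB _ _)) // mulrDl mul1r lerD.
apply/negP; rewrite -leNgt (le_trans (ler_normB _ _)) // !normrM.
rewrite (_ : eps * _ = `|v i j2 - v i j1| * (2 * eps) + `|v i j3 - v i j1| * (2 * eps)).
  by rewrite lerD // ler_wpM2l.
by ring.
Qed.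

End Family.

(** * Assembling the colors *)

Local Open Scope card_scope.

(* uphalf d.+1 is the ceiling of (d + 1) / 2; [`I_n #<= A] says that the set A,
   finite or not, has at least n elements. *)
Theorem theorem10 (R : realType) (d f : nat) (hd : (2 <= d)%N) (hf : (1 <= f)%N) :
  exists F : 'I_d -> set (set 'rV[R]_d),
    [/\ colored_convex_family F,
        colorful_helly F,
        forall (i : 'I_d) (P : set 'rV[R]_d), pierces P (F i) -> `I_f #<= P
      & forall L : set (set 'rV[R]_d), (forall l, L l -> is_line l) ->
          crosses L (\bigcup_(i in [set: 'I_d]) F i) -> `I_(uphalf d.+1) #<= L].
Proof.
case: d hd => // k _.
have n0 : (0 < 2 * f)%N by rewrite muln_gt0.
have [v [c [vc ph]]] := parallel_hyperplane R k n0.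
have [eps eps0 noconc] := slabs_not_concurrent vc.
have eps_ge0 := ltW eps0.
(* With m = floor(d / 2), the required number of lines is m + 1, and 2m <= d is what
   [parallel_hyperplane] asks of m directions. *)
have mk : (2 * k.+1./2 <= k.+1)%N by rewrite mul2n -[leqRHS]odd_double_half leq_addl.
have [G [finG GP Gavoid]] := finite_plates eps0 (fun U => ph k.+1./2 U mk).
pose F (i : 'I_k.+1) : set (set 'rV[R]_k.+1) :=
  if unlift ord0 i is Some i' then [set slab v c eps i' j | j in [set: 'I_(2 * f)]]
  else G `|` [set @level R k l | l in `I_f].
have F0 : F ord0 = G `|` [set @level R k l | l in `I_f] by rewrite /F unlift_none.
have FS i : F (lift ord0 i) = [set slab v c eps i j | j in [set: 'I_(2 * f)]].
  by rewrite /F liftK.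
have F_disj i : F ord0 `&` F (lift ord0 i) = set0.
  apply/seteqP; split=> // K []; rewrite F0 FS => -[GK|[l _ <-]] [j _].
    by have [_ [psi [a [B ->]]]] := GP _ GK; exact: slab_neq_plate.
  exact: slab_neq_level.
exists F; split.
- split.
  + move=> i; case: (unliftP ord0 i) => [i'|] ->; first by rewrite FS; exact: finite_image.
    by rewrite F0 finite_setU; split => //; exact: finite_image.
  + apply/trivIsetP => i j _ _.
    case: (unliftP ord0 i) => [i'|] ->; case: (unliftP ord0 j) => [j'|] -> ij.
    * apply/seteqP; split=> // K []; rewrite !FS => -[a _ <-] [b _ /esym/slab_inj_color E].
      by case/eqP: ij; rewrite (E eps_ge0).
    * by rewrite setIC.
    * exact: F_disj.
    * by rewrite eqxx in ij.
  + move=> i K; case: (unliftP ord0 i) => [i'|] ->.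
      by rewrite FS => -[j _ <-]; exact: slab_convex.
    rewrite F0 => -[GK|[l _ <-]]; last exact: level_convex.
    by have [_ [psi [a [B ->]]]] := GP _ GK; exact: plate_convex.
- move=> K KF.
  have /fin_all_exists[s sP] i : exists j, K (lift ord0 i) = slab v c eps i j.
    by have := KF (lift ord0 i); rewrite FS => -[j _ <-]; exists j.
  suff [x x0 xs] : exists2 x, K ord0 x & forall i, slab v c eps i (s i) x.
    by exists x => i _; case: (unliftP ord0 i) => [i'|] ->; rewrite ?sP.
  have := KF ord0; rewrite F0 => -[GK|[l _ <-]].
    have [/(_ [ffun i => s i])[x Kx xs] _] := GP _ GK.
    by exists x => // i; have := xs i; rewrite ffunE.
  (* The central line of the selection at time t = l. *)
  exists (pt l%:R (fun i => v i (s i) * l%:R + c i (s i))); first by rewrite /level /= pt0.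
  by move=> i; rewrite /slab /= pt0 pt_lift addrAC addrK subrr normr0.
- move=> i P; case: (unliftP ord0 i) => [i'|] ->; rewrite ?F0 ?FS => PF.
    have /fin_all_exists2[p Pp sp] j : exists2 x, P x & slab v c eps i' j x.
      by apply: PF; exists j.
    apply: (card_ge_half _ Pp) => j1 j2 j3 u e2 e3.
    apply: (noconc i' j1 j2 j3 (p j1) u (sp j1)); first by rewrite e2; exact: sp.
    by rewrite e3; exact: sp.
  have /fin_all_exists2[p Pp lp] (l : 'I_f) : exists2 x, P x & @level R k l x.
    by apply: PF; right; exists l => //; exact: ltn_ord.
  apply: card_ge_injective Pp => l l' E; apply: val_inj; apply/eqP.
  by have := lp l; rewrite /level /= E (lp l') => /eqP; rewrite eqr_nat eq_sym.
- move=> L linL crL; apply: contrapT => nL.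
  have qE : uphalf k.+2 = (k.+1./2).+1 by rewrite uphalfE /=.
  rewrite qE in nL; have [g gL] := card_lt_enum (set0 : set 'rV[R]_k.+1) nL.
  have /fin_all_exists[pu puP] a : exists pu : 'rV[R]_k.+1 * 'rV[R]_k.+1, pu.2 != 0 /\
      (L (g a) -> g a = range (fun t : R => pu.1 + t *: pu.2)).
    have [/linL[p [u [u0 gE]]]|nLa] := pselect (L (g a)); first by exists (p, u).
    (* An entry of the list outside L gets an arbitrary line. *)
    exists (0, delta_mx 0 0); split=> //=.
    by apply/eqP => /rowP/(_ 0)/eqP; rewrite !mxE !eqxx oner_eq0.
  have [K GK avoid] := Gavoid (fun a => (pu a).1) (fun a => (pu a).2) (fun a => (puP a).1).
  have [|l Ll [x [Kx lx]]] := crL K; first by exists ord0 => //; rewrite F0; left.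
  have [a ga] := gL l Ll; move: lx; rewrite -ga in Ll *.
  by rewrite (puP a).2 // => -[t _ tx]; apply: (avoid a t); rewrite tx.
Qed.
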